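(* Let $m$ be a positive integer such that a Hadamard matrix of order $m$ exists. Then there exists a balancedly splittable Hadamard matrix of order $m^2$ with parameters $(m^2,(m-1)^2,1,-m+1)$, and one with parameters $(m^2,2m-2,m-2,-2)$.
   Context: A Hadamard matrix of order $n$ is an $n\times n$ $\{1,-1\}$-matrix $H$ with $HH^\top=nI_n$; $J_n$ is the all-ones matrix. $H$ is balancedly splittable with parameters $(n,\ell,a,b)$ if, after permuting its rows, $H=\begin{pmatrix}H_1\\H_2\end{pmatrix}$ with $H_1$ an $\ell\times n$ matrix such that $H_1^\top H_1=\ell I_n+aA+b(J_n-A-I_n)$ for a symmetric $(0,1)$-matrix $A$ with zero diagonal. *)

(* Defs.v *)
From mathcomp Require Import all_boot all_order all_fingroup all_algebra.

Set Implicit Arguments.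
Unset Strict Implicit.
Unset Printing Implicit Defensive.

Import GRing.Theory.
Local Open Scope ring_scope.

Definition hadamard (n : nat) (H : 'M[int]_n) : Prop :=
  (forall i j, H i j = 1 \/ H i j = -1) /\ H *m H^T = n%:R%:M.

(* The order n is carried by the type of H; the cast only identifies
   'M_(l + k, n) with 'M_n. *)
Definition balancedly_splittable (n : nat) (H : 'M[int]_n)
    (l : nat) (a b : int) : Prop :=
  exists (k : nat) (lk : (l + k = n)%N) (s : 'S_n)
         (H1 : 'M[int]_(l, n)) (H2 : 'M[int]_(k, n)) (A : 'M[int]_n),
    [/\ row_perm s H = castmx (lk, erefl n) (col_mx H1 H2),
        forall i j, A i j = 0 \/ A i j = 1,
        A^T = A,
        forall i, A i i = 0
      & H1^T *m H1 = l%:R%:M + a *: A + b *: (const_mx 1 - A - 1%:M)].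

(* Main.v *)
Require Import Defs.
From mathcomp Require Import all_boot all_order all_fingroup all_algebra.

Set Implicit Arguments.
Unset Strict Implicit.
Unset Printing Implicit Defensive.

Import GRing.Theory.
Local Open Scope ring_scope.

(** Normalize the given matrix to [N], whose first row is constantly [1], and
    take [K := N (x) N].  Since [N^T N = m I], removing the first row of [N]
    leaves the Gram matrix [m I - J].  The rows [(i, i')] of [K] with [i] and
    [i'] both nonzero thus have Gram matrix [(m I - J) (x) (m I - J)], and those
    with exactly one of [i], [i'] zero have Gram matrix
    [(m I - J) (x) J + J (x) (m I - J)]; their off-diagonal entries are
    [1], [1 - m] and [m - 2], [-2] respectively. *)

Lemma sign_mul_self (x : int) : x = 1 \/ x = -1 -> x * x = 1.
Proof. by case=> ->; rewrite ?mulr1 ?mulrNN ?mulr1. Qed.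

Section SplitEnumeration.
Variables (T : finType) (P : {pred T}).

Definition split_enum (i : 'I_(#|P| + #|[predC P]|)) : T :=
  match split i with inl j => enum_val j | inr j => enum_val j end.

Lemma split_enum_lshift (i : 'I_#|P|) :
  split_enum (lshift _ i) = enum_val i.
Proof. by rewrite /split_enum (unsplitK (inl i)). Qed.

Lemma split_enum_inj : injective split_enum.
Proof.
have disj (i : 'I_#|P|) (j : 'I_#|[predC P]|) : enum_val i <> enum_val j.
  by move=> eq_ij; have := enum_valP j; rewrite -eq_ij inE /= enum_valP.
move=> i i'; rewrite /split_enum; case: split_ordP => j ->;
  case: split_ordP => j' ->.
- by move/enum_val_inj->.
- by move/disj.
- by move/esym/disj.
- by move/enum_val_inj->.
Qed.

Lemma split_enum_bij : bijective split_enum.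
Proof. by apply: (inj_card_bij split_enum_inj); rewrite card_ord cardC. Qed.

End SplitEnumeration.

(* Listing the rows in [P] first makes the row permutation trivial. *)
Lemma balancedly_splittable_of_gram (T : finType) (x0 : T) (h : T -> T -> int)
    (P : {pred T}) (adj : rel T) (n l : nat) (a b : int) :
    #|T| = n ->
    (forall x y, h x y = 1 \/ h x y = -1) ->
    (forall x y, \sum_z h x z * h y z = n%:R *+ (x == y)) ->
    symmetric adj ->
    (forall x y, \sum_(z in P) h z x * h z y =
       if x == y then l%:R else if adj x y then a else b) ->
  exists H : 'M[int]_n, hadamard H /\ balancedly_splittable H l a b.
Proof.
move=> cardT h_sign h_orth adj_sym h_gram.
(* Each summand of a diagonal Gram entry is the square of a sign, so this entry counts the rows in
   [P]. *)
have cardP : #|P| = l.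
  have := h_gram x0 x0; rewrite eqxx.
  under eq_bigr => z _ do rewrite (sign_mul_self (h_sign z x0)).
  by rewrite sumr_const; move/eqP; rewrite Num.Theory.eqr_nat => /eqP.
(* Writing the order as [#|P| + #|[predC P]|] lets [erefl] serve as the splitting equation, so the
   cast becomes trivial. *)
move: cardT; rewrite -(cardC P) => cardT.
subst n l; pose r := @split_enum T P.
have r_inj i j : (r i == r j) = (i == j) := inj_eq (@split_enum_inj T P) i j.
pose H := \matrix_(i, j) h (r i) (r j); exists H; split.
  split=> [i j|]; first by rewrite mxE.
  apply/matrixP=> i j; rewrite !mxE -r_inj -h_orth.
  rewrite (reindex _ (onW_bij _ (split_enum_bij P))).
  by apply: eq_bigr => k _; rewrite !mxE.
(* [adj] may hold on the diagonal, so the witness for [A] masks it with [r i != r j]. *)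
exists _, erefl, 1%g, (usubmx H), (dsubmx H),
  (\matrix_(i, j) ((r i != r j) && adj (r i) (r j))%:R).
split=> [|i j||i|].
- by rewrite row_perm1 castmx_id vsubmxK.
- by rewrite mxE; case: (_ && _); [right | left].
- by apply/matrixP=> i j; rewrite !mxE eq_sym adj_sym.
- by rewrite mxE eqxx.
- apply/matrixP=> i j; rewrite !mxE.
  under eq_bigr => k _ do rewrite !mxE /r split_enum_lshift.
  rewrite -(big_enum_val (A := P) (fun z => h z (r i) * h z (r j))) h_gram r_inj.
  case: (i == j) => /=.
    by rewrite mulr0 addr0 subr0 subrr mulr0 addr0.
  case: (adj _ _) => /=.
    by rewrite mulr0n add0r mulr1 !subr0 subrr mulr0 addr0.
  by rewrite mulr0n add0r mulr0 add0r !subr0 mulr1.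
Qed.

(** A one-sided inverse up to a scalar is two-sided. Over [int], [H^T] is cancelled on the right by
    multiplying with its adjugate and dividing each entry by the nonzero [\det H^T]. *)
Lemma hadamard_tr_mul (n : nat) (H : 'M[int]_n) :
  hadamard H -> H^T *m H = n%:R%:M.
Proof.
case: n H => [|n] H [_ HHt]; first by apply/matrixP=> - [].
have detH : \det H^T != 0.
  apply/eqP=> dH0; have /(congr1 determinant) := HHt.
  rewrite det_mulmx dH0 mulr0 det_scalar => /esym/eqP.
  by rewrite expf_eq0 Num.Theory.pnatr_eq0.
have : (H^T *m H - n.+1%:R%:M) *m H^T = 0.
  by rewrite mulmxBl -mulmxA HHt mul_mx_scalar mul_scalar_mx subrr.
move/(congr1 (mulmxr (\adj H^T))); rewrite /= mul0mx -mulmxA mul_mx_adj.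
rewrite mul_mx_scalar => /matrixP eq0; apply/matrixP=> i j.
apply/eqP; rewrite -subr_eq0; have := eq0 i j; rewrite mxE.
by move/eqP; rewrite [X in _ == X]mxE mulf_eq0 (negPf detH) !mxE.
Qed.

(** Multiply each column by its own top entry; these signs square to 1 in every row inner
    product. *)
Lemma hadamard_normalize (p : nat) (H : 'M[int]_p.+1) :
  hadamard H -> exists2 N : 'M[int]_p.+1, hadamard N & forall j, N 0 j = 1.
Proof.
move=> [H_sign HHt]; exists (\matrix_(i, j) (H i j * H 0 j)); last first.
  by move=> j; rewrite mxE sign_mul_self.
split=> [i j|].
  rewrite mxE; case: (H_sign i j) (H_sign 0 j) => -> [] ->;
  by rewrite ?mulr1 ?mul1r ?opprK; auto.
rewrite -HHt; apply/matrixP=> i j; rewrite !mxE; apply: eq_bigr => k _.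
by rewrite !mxE mulrACA (sign_mul_self (H_sign 0 k)) mulr1.
Qed.

Section TensorSquare.
Variables (p : nat) (N : 'M[int]_p.+1).
Hypotheses (N_had : hadamard N) (N_row0 : forall j, N 0 j = 1).

(** Indexing the Kronecker square by pairs makes sums over rows or columns factor by coordinate. *)
Definition tensor_square (x y : 'I_p.+1 * 'I_p.+1) : int :=
  N x.1 y.1 * N x.2 y.2.

Lemma tensor_square_sign x y :
  tensor_square x y = 1 \/ tensor_square x y = -1.
Proof.
rewrite /tensor_square; case: N_had => N_sign _.
case: (N_sign x.1 y.1) (N_sign x.2 y.2) => -> [] ->;
by rewrite ?mulr1 ?mul1r ?opprK; auto.
Qed.

Lemma tensor_square_orth x y :
  \sum_z tensor_square x z * tensor_square y z =
  (p.+1 ^ 2)%N%:R *+ (x == y).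
Proof.
have N_orth i j : \sum_k N i k * N j k = p.+1%:R *+ (i == j).
  case: N_had => _ /matrixP/(_ i j); rewrite !mxE => <-.
  by apply: eq_bigr => k _; rewrite mxE.
rewrite /tensor_square.
under eq_bigr => z _ do rewrite mulrACA.
rewrite -(pair_bigA _ (fun j k => N x.1 j * N y.1 j * (N x.2 k * N y.2 k))) /=.
rewrite -big_distrlr /= !N_orth mulrnAl mulrnAr -mulrnA mulnb -natrM mulnn andbC.
by case: x y => [? ?] [? ?].
Qed.

(** The columns are orthogonal too, and the all-ones row 0 contributes exactly 1 to each of their
    inner products. *)
Lemma gram_nonzero_rows i j :
  \sum_(k | k != 0) N k i * N k j = p.+1%:R *+ (i == j) - 1.
Proof.
have /matrixP/(_ i j) := hadamard_tr_mul N_had; rewrite !mxE => <-.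
rewrite [in RHS](bigD1 0) //= mxE !N_row0 mulr1 [RHS]addrC addKr.
by apply: eq_bigr => k _; rewrite mxE.
Qed.

Lemma gram_both_nonzero x y :
  \sum_(z in [predX predC1 0 & predC1 0]) tensor_square z x * tensor_square z y
  = (p.+1%:R *+ (x.1 == y.1) - 1) * (p.+1%:R *+ (x.2 == y.2) - 1).
Proof.
rewrite -!gram_nonzero_rows big_distrlr /= pair_big /=.
by apply: eq_big => z; rewrite ?inE // /tensor_square mulrACA.
Qed.

Lemma gram_one_nonzero x y :
  \sum_(z in [pred z | (z.1 == 0) (+) (z.2 == 0)])
    tensor_square z x * tensor_square z y
  = (p.+1%:R *+ (x.1 == y.1) - 1) + (p.+1%:R *+ (x.2 == y.2) - 1).
Proof.
under eq_bigr => z _ do rewrite /tensor_square mulrACA.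
rewrite -(pair_big_dep predT (fun i j => (i == 0) (+) (j == 0))
  (fun i j => N i x.1 * N i y.1 * (N j x.2 * N j y.2))) /=.
(* Rows with [i = 0] leave a sum over [j != 0]; each [i != 0] forces [j = 0]. *)
rewrite -!gram_nonzero_rows (bigD1 0) //= [RHS]addrC; congr (_ + _).
  by apply: eq_bigr => j _; rewrite !N_row0 !mul1r.
apply: eq_bigr => i /negPf i0; rewrite i0 /= big_pred1_eq.
by rewrite !N_row0 !mulr1.
Qed.

End TensorSquare.

Theorem theorem3p1 (m : nat) (m_gt0 : (0 < m)%N)
    (exH : exists H : 'M[int]_m, hadamard H) :
  (exists H : 'M[int]_(m ^ 2),
     hadamard H /\
     balancedly_splittable H ((m - 1) ^ 2)%N 1 (- m%:Z + 1)) /\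
  (exists H : 'M[int]_(m ^ 2),
     hadamard H /\
     balancedly_splittable H (2 * m - 2)%N (m%:Z - 2) (-2)).
Proof.
case: m m_gt0 exH => // p _ [H /hadamard_normalize [N N_had N_row0]].
have cardT : #|{: 'I_p.+1 * 'I_p.+1}| = (p.+1 ^ 2)%N.
  by rewrite card_prod card_ord mulnn.
have N_sign := tensor_square_sign N_had.
have N_orth := tensor_square_orth N_had.
have p1 : p.+1%:R - 1 = p%:R :> int by rewrite -natr1 addrK.
split.
(* Each factor of the Gram entry is [p] (that is, m - 1) if the coordinates agree and -1 otherwise,
   so the product is 1 exactly when both differ, and [- p] when one does. *)
- pose adj (x y : 'I_p.+1 * 'I_p.+1) := (x.1 != y.1) && (x.2 != y.2).
  apply: (balancedly_splittable_of_gram (0, 0)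
            (P := [predX predC1 0 & predC1 0]) (adj := adj)
            cardT N_sign N_orth) => [x y|x y].
    by rewrite /adj eq_sym [x.2 == _]eq_sym.
  rewrite (gram_both_nonzero N_had N_row0) -pair_eqE /pair_eq /adj /=.
  rewrite subn1 /= -natz.
  case: (x.1 == _); case: (x.2 == _); rewrite /= ?mulr1n ?mulr0n ?p1 ?sub0r.
  + by rewrite -natrM mulnn.
  + by rewrite mulrN1 -p1 opprB addrC.
  + by rewrite mulN1r -p1 opprB addrC.
  + by rewrite mulrNN mulr1.
(* The same two values are now added: one agreement gives [p - 1], which is m - 2, and none gives
   -2. *)
- pose adj (x y : 'I_p.+1 * 'I_p.+1) := (x.1 == y.1) (+) (x.2 == y.2).
  apply: (balancedly_splittable_of_gram (0, 0)
            (P := [pred z | (z.1 == 0) (+) (z.2 == 0)]) (adj := adj)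
            cardT N_sign N_orth) => [x y|x y].
    by rewrite /adj eq_sym [x.2 == _]eq_sym.
  rewrite (gram_one_nonzero N_had N_row0) -pair_eqE /pair_eq /adj /=.
  rewrite mulnS addKn -natz.
  case: (x.1 == _); case: (x.2 == _); rewrite /= ?mulr1n ?mulr0n ?sub0r.
  + by rewrite p1 -natrD addnn mul2n.
  + by rewrite -addrA -opprD.
  + by rewrite addrCA -opprD.
  + by rewrite -opprD.
Qed.
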